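(* Let $K$ be either the field $\mathbb{C}$ of complex numbers with the Euclidean norm, or an algebraically closed field $\mathbb{K}$ with a complete and non-Archimedean norm. Let $U$ be an open subset of $K$ and let $f$ be a polynomial map over $K$ of degree $d \geq 2$. Suppose that there exist two distinct elements $\alpha$ and $\beta$ in $K$ such that $$\bigcup_{k=0}^{\infty} f^{k}(U) \cap \{\alpha, \beta\} = \emptyset .$$ Then the polynomial map $f$ is equicontinuous on $U$ with respect to the chordal metric on $\mathbb{P}^1_K$. Moreover, if $K = \mathbb{K}$ (the non-Archimedean case), then the same conclusion is also true even when $\alpha = \beta$.
   Context: The norm on $K$ is denoted $|\cdot|$. In the case $K=\mathbb{K}$ it is a multiplicative absolute value satisfying $|x+y| \leq \max\{|x|,|y|\}$, with respect to which $\mathbb{K}$ is complete. Here $f^k$ denotes the $k$-th iterate of $f$, with $f^0 = \mathrm{id}$. The projective line over $K$ is $\mathbb{P}^1_K = K \cup \{\infty\}$, and a polynomial map $f$ of degree $\geq 2$ acts on it with $f(\infty) = \infty$. For $z \in K$ put $\|z\| := \sqrt{1+|z|^2}$ if $K = \mathbb{C}$, and $\|z\| := \max\{1, |z|\}$ if $K = \mathbb{K}$. The chordal metric $\rho$ on $\mathbb{P}^1_K$ is the (symmetric) metric given by $$\rho(z,w) = \frac{|z-w|}{\|z\|\cdot\|w\|} \quad (z,w \in K), \qquad \rho(z,\infty) = \frac{1}{\|z\|} \quad (z \in K),$$ and $\rho(\infty,\infty)=0$. Equicontinuity: let $X$ be a metric space with metric $d_X$, $U \subset X$ an open set, and $f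 : X \to X$ a continuous map. We say that $f$ is equicontinuous on $U$ if for every $x \in U$ and every $\epsilon > 0$ there is an open neighborhood $V_x$ of $x$ such that $d_X(f^k(y), f^k(x)) < \epsilon$ for all $y \in V_x$ and all $k \in \{0, 1, 2, \dots\}$. In the claim this is applied with $X = \mathbb{P}^1_K$ and $d_X = \rho$. *)

(* Defs.v *)
From HB Require Import structures.
From mathcomp Require Import all_boot all_order all_algebra.
From mathcomp Require Import all_classical all_reals all_analysis.
From mathcomp Require Export complex.
From mathcomp Require Import ring lra.

Set Implicit Arguments.
Unset Strict Implicit.
Unset Printing Implicit Defensive.

Import Order.TTheory GRing.Theory Num.Theory.

Local Open Scope classical_set_scope.
Local Open Scope ring_scope.

(* The field C is [Rcomplex R], i.e. R[i] with the R-valued modulus as its norm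
   (on R[i] itself, mathcomp's norm takes its values in R[i]).  We give it the
   metric topology of that norm. *)
Section RcomplexTopology.
Variable R : realType.
Local Notation C := (Rcomplex R).

Let dist (x y : C) : R := `|y - x|.

Let distxx x : dist x x = 0.
Proof. by rewrite /dist subrr normr0. Qed.

Let dist_positivity x y : dist x y = 0 -> x = y.
Proof. by move/normr0_eq0/eqP; rewrite subr_eq0 => /eqP. Qed.

Let dist_sym x y : dist x y = dist y x.
Proof. exact: distrC. Qed.

Let dist_triangle y x z : dist x z <= dist x y + dist y z.
Proof. by rewrite /dist [leRHS]addrC; exact: ler_distD. Qed.

HB.instance Definition _ := isPointed.Build C 0.
HB.instance Definition _ :=
  @isMetric.Build R C dist distxx dist_positivity dist_sym dist_triangle.
HB.instance Definition _ :=
  @NormedZmoduleMetric.Build R C (fun _ _ => erefl).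

End RcomplexTopology.

(* A multiplicative, possibly trivial, non-Archimedean absolute value.  This
   cannot be an instance of normedZmodType, which requires
   `|x *+ n| = `|x| *+ n. *)
Record nonArchAbs (R : realType) (K : fieldType) := NonArchAbs {
  na_abs :> K -> R;
  na_ge0 : forall x, 0 <= na_abs x;
  na_eq0 : forall x, na_abs x = 0 <-> x = 0;
  na_M : forall x y, na_abs (x * y) = na_abs x * na_abs y;
  na_D : forall x y, na_abs (x + y) <= Num.max (na_abs x) (na_abs y)
}.

(* The field K with the metric topology of the absolute value v. *)
Definition valued (R : realType) (K : closedFieldType) (v : nonArchAbs R K)
  : Type := K.

Section ValuedTopology.
Variables (R : realType) (K : closedFieldType) (v : nonArchAbs R K).
Local Notation KV := (valued v).

HB.instance Definition _ := GRing.ClosedField.on KV.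
HB.instance Definition _ := isPointed.Build KV 0.

Lemma na_abs0 : v 0 = 0.
Proof. exact/na_eq0. Qed.

Lemma na_leD x y : v (x + y) <= v x + v y.
Proof. by rewrite (le_trans (na_D v x y))// ge_max lerDl lerDr !na_ge0. Qed.

Lemma na_abs1 : v 1 = 1.
Proof.
have v1 : v 1 != 0 by apply/eqP => /na_eq0/eqP; rewrite oner_eq0.
by apply: (mulfI v1); rewrite -na_M !mulr1.
Qed.

Lemma na_absN x : v (- x) = v x.
Proof.
have vN1 : v (-1) = 1.
  apply/eqP; rewrite -(eqrXn2 (n := 2))// ?na_ge0// expr1n expr2 -na_M.
  by rewrite mulrNN mulr1 na_abs1.
by rewrite -mulN1r na_M vN1 mul1r.
Qed.

Let dist (x y : KV) : R := v (x - y).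

Let distxx x : dist x x = 0.
Proof. by rewrite /dist subrr na_abs0. Qed.

Let dist_positivity x y : dist x y = 0 -> x = y.
Proof. by move/na_eq0/eqP; rewrite subr_eq0 => /eqP. Qed.

Let dist_sym x y : dist x y = dist y x.
Proof. by rewrite /dist -na_absN opprB. Qed.

Let dist_triangle y x z : dist x z <= dist x y + dist y z.
Proof. by rewrite /dist -(subrKA y x) na_leD. Qed.

HB.instance Definition _ :=
  @isMetric.Build R KV dist distxx dist_positivity dist_sym dist_triangle.

End ValuedTopology.

Definition complete_space (T : puniformType) : Prop :=
  forall F : set_system T, ProperFilter F -> cauchy F -> cvg F.

(* Points of the projective line are [Some z] for z in K, and [None] for the
   point at infinity.  The function [h] is z |-> ||z||. *)
Definition chordal (R : realType) (K : zmodType) (nrm h : K -> R)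
    (z w : option K) : R :=
  match z, w with
  | Some z, Some w => nrm (z - w) / (h z * h w)
  | Some z, None => (h z)^-1
  | None, Some w => (h w)^-1
  | None, None => 0
  end.

Section ChordalMetric.
Variables (R : realType) (K : zmodType) (nrm h : K -> R).
Hypothesis nrm_eq0 : forall z, nrm z = 0 <-> z = 0.
Hypothesis nrmN : forall z, nrm (- z) = nrm z.
Hypothesis nrmD : forall z w, nrm (z + w) <= nrm z + nrm w.
Hypothesis h_gt0 : forall z, 0 < h z.
Hypothesis norm_le_h : forall z, nrm z <= h z.
Hypothesis hD : forall z w, h z <= h w + nrm (z - w).
Hypothesis h_ptolemy :
  forall u z w, nrm (z - w) * h u <= nrm (z - u) * h w + nrm (u - w) * h z.

Let nrmC z w : nrm (z - w) = nrm (w - z).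
Proof. by rewrite -nrmN opprB. Qed.

Lemma chordalxx x : chordal nrm h x x = 0.
Proof. by case: x => //= z; rewrite subrr (nrm_eq0 0).2// mul0r. Qed.

Lemma chordal_positivity x y : chordal nrm h x y = 0 -> x = y.
Proof.
have h0 z : h z != 0 by rewrite gt_eqF.
case: x y => [z|] [w|] //= /eqP; last 2 first.
- by rewrite invr_eq0 (negbTE (h0 _)).
- by rewrite invr_eq0 (negbTE (h0 _)).
rewrite mulf_eq0 invr_eq0 mulf_eq0 !(negbTE (h0 _)) !orbF => /eqP/nrm_eq0/eqP.
by rewrite subr_eq0 => /eqP->.
Qed.

Lemma chordal_sym x y : chordal nrm h x y = chordal nrm h y x.
Proof. by case: x y => [z|] [w|] //=; rewrite nrmC (mulrC (h z)). Qed.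

Lemma chordal_triangle y x z :
  chordal nrm h x z <= chordal nrm h x y + chordal nrm h y z.
Proof.
have h0 t : h t != 0 by rewrite gt_eqF.
have hV t : 0 <= (h t)^-1 by rewrite invr_ge0 ltW.
have half a b : (h a)^-1 <= nrm (a - b) / (h a * h b) + (h b)^-1.
  have -> : nrm (a - b) / (h a * h b) + (h b)^-1 =
            (h a)^-1 * (h b)^-1 * (h a + nrm (a - b)) by field; rewrite !h0.
  rewrite -[leLHS](mulfVK (h0 b)).
  by rewrite ler_wpM2l ?mulr_ge0// nrmC hD.
case: x y z => [x|] [y|] [z|] //=.
- have -> : nrm (x - z) / (h x * h z) =
     (h x)^-1 * (h y)^-1 * (h z)^-1 * (nrm (x - z) * h y) by field; rewrite !h0.
  have -> : nrm (x - y) / (h x * h y) + nrm (y - z) / (h y * h z) =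
     (h x)^-1 * (h y)^-1 * (h z)^-1 * (nrm (x - y) * h z + nrm (y - z) * h x).
    by field; rewrite !h0.
  by rewrite ler_wpM2l ?mulr_ge0.
- have -> : (h x)^-1 + (h z)^-1 = (h x)^-1 * (h z)^-1 * (h x + h z).
    by field; rewrite !h0.
  rewrite mulrC invfM ler_wpM2l ?mulr_ge0//.
  by rewrite (le_trans (nrmD _ _))// nrmN lerD.
- by rewrite addr0.
- by rewrite addrC nrmC (mulrC (h y)) half.
- by rewrite addr_ge0.
- by rewrite add0r.
Qed.

End ChordalMetric.

Section ComplexProjectiveLine.
Variable R : realType.
Local Notation C := (Rcomplex R).

Definition absC (z : C) : R := `|z|.

Lemma absC_eq0 z : absC z = 0 <-> z = 0.
Proof. by split=> [/normr0_eq0//|->]; rewrite /absC normr0. Qed.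

Lemma absCN z : absC (- z) = absC z.
Proof. exact: normrN. Qed.

Lemma absCD z w : absC (z + w) <= absC z + absC w.
Proof. exact: ler_normD. Qed.

Lemma absC_ge0 z : 0 <= absC z.
Proof. exact: normr_ge0. Qed.

Lemma absCM z w : absC (z * w) = absC z * absC w.
Proof. exact: Normc.normcM. Qed.

Definition cnorm1 (z : C) : R := Num.sqrt (1 + absC z ^+ 2).

Lemma cnorm1_gt0 z : 0 < cnorm1 z.
Proof. by rewrite sqrtr_gt0 ltr_pwDl// sqr_ge0. Qed.

Lemma cnorm1_ge0 z : 0 <= cnorm1 z.
Proof. by rewrite ltW ?cnorm1_gt0. Qed.

Lemma sqr_cnorm1 z : cnorm1 z ^+ 2 = 1 + absC z ^+ 2.
Proof. by rewrite sqr_sqrtr// addr_ge0// sqr_ge0. Qed.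

Lemma norm_le_cnorm1 z : absC z <= cnorm1 z.
Proof.
rewrite -(ler_pXn2r (n := 2))// ?nnegrE ?absC_ge0 ?cnorm1_ge0//.
by rewrite sqr_cnorm1 lerDr.
Qed.

Lemma cnorm1D z w : cnorm1 z <= cnorm1 w + absC (z - w).
Proof.
have a0 : 0 <= cnorm1 w by rewrite ltW ?cnorm1_gt0.
rewrite -(ler_pXn2r (n := 2))// ?nnegrE ?addr_ge0 ?absC_ge0 ?cnorm1_ge0//.
have zw : absC z <= absC w + absC (z - w) by rewrite -{1}(subrK w z) addrC absCD.
have zw2 : absC z ^+ 2 <= (absC w + absC (z - w)) ^+ 2.
  by rewrite ler_pXn2r// nnegrE ?addr_ge0 ?absC_ge0.
have ww : absC w * absC (z - w) <= cnorm1 w * absC (z - w).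
  by rewrite ler_wpM2r ?absC_ge0// norm_le_cnorm1.
rewrite sqrrD in zw2; rewrite sqrrD !sqr_cnorm1; lra.
Qed.

Lemma sqr_absC (x : C) : absC x ^+ 2 = complex.Re x ^+ 2 + complex.Im x ^+ 2 :> R.
Proof. by case: x => a b; rewrite sqr_sqrtr// addr_ge0// sqr_ge0. Qed.

Lemma conjc_cnorm1 (u w : C) : absC (1 + (conjc u : C) * w) <= cnorm1 u * cnorm1 w.
Proof.
rewrite -(ler_pXn2r (n := 2))// ?nnegrE ?mulr_ge0 ?absC_ge0 ?cnorm1_ge0//.
rewrite exprMn !sqr_cnorm1 !sqr_absC.
case: u w => [a b] [c d] /=.
have := sqr_ge0 (a - c); have := sqr_ge0 (b - d).
rewrite !expr2; lra.
Qed.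

Lemma cnorm1_ptolemy (u z w : C) :
  absC (z - w) * cnorm1 u <= absC (z - u) * cnorm1 w + absC (u - w) * cnorm1 z.
Proof.
rewrite -(ler_pM2r (cnorm1_gt0 u)).
have uu : absC (1 + (conjc u : C) * u) = cnorm1 u * cnorm1 u.
  apply/eqP; rewrite -(eqrXn2 (n := 2)) ?absC_ge0 ?mulr_ge0 ?cnorm1_ge0//.
  rewrite exprMn sqr_cnorm1 !sqr_absC.
  by case: u => a b /=; apply/eqP; ring.
have -> : absC (z - w) * cnorm1 u * cnorm1 u =
    absC ((z - u) * (1 + (conjc u : C) * w) + (u - w) * (1 + (conjc u : C) * z)).
  by rewrite -mulrA -uu -absCM; congr (absC _); ring.
apply: le_trans (absCD _ _) _; rewrite !absCM mulrDl -!mulrA lerD//.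
  by rewrite ler_wpM2l ?absC_ge0// [leRHS]mulrC conjc_cnorm1.
by rewrite ler_wpM2l ?absC_ge0// [leRHS]mulrC conjc_cnorm1.
Qed.

Definition complexP1 := option C.

HB.instance Definition _ := Choice.on complexP1.
HB.instance Definition _ := @isMetric.Build R complexP1 (chordal absC cnorm1)
  (chordalxx cnorm1 absC_eq0)
  (chordal_positivity absC_eq0 cnorm1_gt0)
  (chordal_sym cnorm1 absCN)
  (chordal_triangle absCN absCD cnorm1_gt0
     norm_le_cnorm1 cnorm1D cnorm1_ptolemy).

End ComplexProjectiveLine.

Section NonArchProjectiveLine.
Variables (R : realType) (K : closedFieldType) (v : nonArchAbs R K).
Local Notation KV := (valued v).

Definition nanorm1 (z : KV) : R := Num.max 1 (v z).

Lemma nanorm1_gt0 z : 0 < nanorm1 z.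
Proof. by rewrite lt_max ltr01. Qed.

Lemma nanorm1_ge0 z : 0 <= nanorm1 z.
Proof. by rewrite ltW ?nanorm1_gt0. Qed.

Lemma norm_le_nanorm1 z : v z <= nanorm1 z.
Proof. by rewrite le_max lexx orbT. Qed.

Lemma nanorm1D z w : nanorm1 z <= nanorm1 w + v (z - w).
Proof.
rewrite ge_max; apply/andP; split.
  by rewrite ler_wpDr ?na_ge0// le_max lexx.
rewrite -{1}(subrK w z) (le_trans (na_leD _ _ _))// addrC.
by rewrite lerD2r norm_le_nanorm1.
Qed.

Lemma nanorm1_ptolemy u z w :
  v (z - w) * nanorm1 u <= v (z - u) * nanorm1 w + v (u - w) * nanorm1 z.
Proof.
suff: v (z - w) * nanorm1 u <=
    Num.max (v (z - u) * nanorm1 w) (v (u - w) * nanorm1 z).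
  move/le_trans; apply; rewrite ge_max lerDl lerDr.
  by rewrite !mulr_ge0 ?na_ge0 ?nanorm1_ge0.
have le1 t : 1 <= nanorm1 t by rewrite le_max lexx.
rewrite {1}/nanorm1 maxr_pMr ?na_ge0// mulr1 ge_max; apply/andP; split.
  rewrite -(subrKA u z) (le_trans (na_D _ _ _))// ge_max.
  by apply/andP; split; rewrite le_max ler_peMr ?na_ge0 ?orbT.
have e : (z - w) * u = (z - u) * w + (u - w) * z by ring.
rewrite -na_M e (le_trans (na_D _ _ _))// !na_M ge_max.
by apply/andP; split; rewrite le_max ler_wpM2l ?na_ge0 ?norm_le_nanorm1 ?orbT.
Qed.

Definition nonArchP1 := option KV.

HB.instance Definition _ := Choice.on nonArchP1.
HB.instance Definition _ := @isMetric.Build R nonArchP1 (chordal v nanorm1)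
  (chordalxx nanorm1 (na_eq0 v))
  (chordal_positivity (na_eq0 v) nanorm1_gt0)
  (chordal_sym nanorm1 (na_absN v))
  (chordal_triangle (na_absN v) (na_leD v) nanorm1_gt0
     norm_le_nanorm1 nanorm1D nanorm1_ptolemy).

End NonArchProjectiveLine.

(* The action of a polynomial of positive degree on the projective line. *)
Definition polyP1 (K : nzRingType) (f : {poly K}) : option K -> option K :=
  omap (horner f).

Definition orbit_set (T : Type) (f : T -> T) (U : set T) : set T :=
  \bigcup_k (iter k f @` U).

Definition equicontinuous_on (R : realType) (X : metricType R)
    (f : X -> X) (U : set X) : Prop :=
  forall x, U x -> forall eps : R, 0 < eps ->
  exists2 V : set X, open_nbhs x V &
    forall y, V y -> forall k : nat, mdist (iter k f y) (iter k f x) < eps.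

(* Main.v *)
Require Import Defs.
From mathcomp Require Import all_boot all_order all_algebra.
From mathcomp Require Import cyclic separable cyclotomic.
From mathcomp Require Import all_classical all_reals all_analysis.
From mathcomp Require Import ring lra.

(** The key tool is a factorization. Write F_k for the k-th iterate of f, a
    polynomial of degree d^k. If F_k omits the value a on the disc of centre x
    and radius r, then F_k - a = c * prod (z - c_i) with at most d^k factors and
    all |x - c_i| >= r, so a move from x to z changes each factor by a relative
    amount of at most t = |z - x| / r.

    Over a non-Archimedean field a product of factors, each changed by a
    relative amount at most t <= 1, changes by a relative amount at most t
    ([zero_free_lipschitz]), whatever the degree. Hence
    |F_k z - F_k x| <= t |F_k x - a|, and dividing by ||F_k x|| bounds the
    chordal distance by a multiple of t that does not depend on k. One omitted
    value is enough.

    Over the complex numbers the error does grow with the number of factors,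
    and what remains is a Harnack inequality for the normalized potential
    L_a,k(z) = ln |F_k z - a| / d^k, namely L_a,k(z) <= L_a,k(x) + t
    ([log_iter_upper]). The same factorization, multiplied over the n-th roots
    of unity w, gives an almost exact mean value inequality
    sum_j L_a,k(x + u w^j) <= n L_a,k(x) + t^n with t = |u| / r
    ([log_iter_mean]).

    Let x be in U. If its orbit escapes to infinity, it does so uniformly near
    x, and the chordal distances tend to 0. If all the orbits that start near x
    are bounded, then they are uniformly bounded and Cauchy's estimates apply;
    for polynomials these come from averages over roots of unity
    ([cauchy_coef]). The remaining case, in which the orbit of x is bounded and
    there are escaping points y arbitrarily near x, is impossible
    ([omitted_orbit_normal]). The set E of all the values that the orbit of U
    omits is backward invariant and contains two points, so it is infinite
    ([backward_invariant_infinite]). For each a in E, L_a,k(x) tends to 0: it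
    is bounded above because the orbit of x is bounded, and below by Harnack and
    the positivity of L_a,k at a nearby escaping point. A second use of Harnack
    bounds all the L_a,k from below near x by a common constant. Now take
    finitely many a in E. At any point z at most one of the L_a,k(z) is
    substantially negative, since F_k z is close to at most one a; so the
    average of the L_a,k over many a is almost nonnegative near x, while at an
    escaping y it stays above some G > 0. The mean value inequality, with
    t^n and the averages at x both small compared with G, contradicts this. *)

Set Implicit Arguments.
Unset Strict Implicit.
Unset Printing Implicit Defensive.

Import Order.TTheory GRing.Theory Num.Theory.

Local Open Scope classical_set_scope.
Local Open Scope ring_scope.

(** * Finite families *)

Lemma prod_const_seq (S : pzSemiRingType) (I : Type) (s : seq I) (x : S) :
  \prod_(i <- s) x = x ^+ size s.
Proof. by rewrite big_const_seq count_predT iter_mulr_1. Qed.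

Lemma sum_const_seq (V : nmodType) (T : Type) (s : seq T) (x : V) :
  \sum_(i <- s) x = x *+ size s.
Proof. by rewrite big_const_seq count_predT iter_addr_0. Qed.

Lemma near_in_seq (T : eqType) (I : Type) (F : set_system I) (FF : Filter F)
    (s : seq T) (P : T -> I -> Prop) :
  (forall a, a \in s -> \forall k \near F, P a k) ->
  \forall k \near F, forall a, a \in s -> P a k.
Proof.
elim: s => [|a s IH] H; first exact: filterE.
have Pa := H a (mem_head _ _).
have {}IH := IH (fun b bs => H b (mem_behead (s := a :: s) bs)).
apply: filterS2 Pa IH => k Pa Ps b; rewrite inE => /orP[/eqP->//|]; exact: Ps.
Qed.

(** Among the terms at most one lies below -B, and that one is at least -A. *)
Lemma sum_ge_almost (R : realType) (T : eqType) (s : seq T) (l : T -> R)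
    (A B : R) :
  uniq s -> 0 <= A -> 0 <= B -> (forall a, a \in s -> - A <= l a) ->
  (forall a b, a \in s -> b \in s -> a != b -> (- B <= l a) || (- B <= l b)) ->
  - A - B *+ size s <= \sum_(a <- s) l a.
Proof.
move=> us A0 B0 lA lB.
have const (t : seq T) : (forall a, a \in t -> - B <= l a) ->
    - (B *+ size t) <= \sum_(a <- t) l a.
  elim: t => [|a t IH] H; first by rewrite big_nil mulr0n oppr0.
  rewrite big_cons mulrS opprD lerD ?H ?mem_head// IH// => b bt.
  by rewrite H// inE bt orbT.
case: (altP (@allP _ (fun a => - B <= l a) s)) => [/const|].
  lra.
rewrite -has_predC => /hasP[a sa /= la].
rewrite (big_rem a)//= lerD ?lA// (le_trans _ (const _ _))//.
  by rewrite lerN2 ler_wpMn2l// size_rem// leq_pred.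
move=> b; rewrite mem_rem_uniq// inE => /andP[ba sb].
by move: (lB _ _ sb sa ba); rewrite (negbTE la) orbF.
Qed.

Lemma ln_prod (R : realType) (T : Type) (s : seq T) (F : T -> R) :
  (forall i, 0 < F i) -> ln (\prod_(i <- s) F i) = \sum_(i <- s) ln (F i).
Proof.
move=> F0; elim: s => [|i s IH]; first by rewrite !big_nil ln1.
by rewrite !big_cons lnM ?IH// posrE// prodr_gt0.
Qed.

(** * Absolute values *)

(** The common setting of both cases: the modulus of a complex number and a
    non-Archimedean absolute value are instances. *)
Record absValue (R : realType) (K : fieldType) := AbsValue {
  abv :> K -> R;
  abv_ge0 : forall x, 0 <= abv x;
  abv_eq0 : forall x, abv x = 0 <-> x = 0;
  abvM : forall x y, abv (x * y) = abv x * abv y;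
  abvD : forall x y, abv (x + y) <= abv x + abv y
}.

Section AbsValueTheory.
Variables (R : realType) (K : fieldType) (v : absValue R K).

Lemma abv0 : v 0 = 0.
Proof. exact/abv_eq0. Qed.

Lemma abv_gt0 x : x != 0 -> 0 < v x.
Proof.
move=> x0; rewrite lt_def abv_ge0 andbT; apply: contraNneq x0.
by move/abv_eq0->.
Qed.

Lemma abv1 : v 1 = 1.
Proof.
have v1 : v 1 != 0 by rewrite gt_eqF ?abv_gt0 ?oner_neq0.
by apply: (mulfI v1); rewrite -abvM !mulr1.
Qed.

Lemma abvX x n : v (x ^+ n) = v x ^+ n.
Proof. by elim: n => [|n IH]; rewrite ?expr0 ?abv1// !exprS abvM IH. Qed.

Lemma abv_unity x n : (0 < n)%N -> x ^+ n = 1 -> v x = 1.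
Proof.
move=> n0 xn; apply/eqP; rewrite -(@eqrXn2 _ n) ?abv_ge0//.
by rewrite expr1n -abvX xn abv1.
Qed.

Lemma abvN x : v (- x) = v x.
Proof. by rewrite -mulN1r abvM (@abv_unity _ 2) ?mul1r// sqrrN expr1n. Qed.

Lemma abv_distC x y : v (x - y) = v (y - x).
Proof. by rewrite -abvN opprB. Qed.

Lemma abvB x y : v (x - y) <= v x + v y.
Proof. by rewrite -(abvN y) abvD. Qed.

Lemma abv_leB x y : v x - v y <= v (x - y).
Proof. by rewrite lerBlDr (le_trans _ (abvD v _ _))// subrK. Qed.

Lemma abvV x : v x^-1 = (v x)^-1.
Proof.
have [->|x0] := eqVneq x 0; first by rewrite invr0 abv0 invr0.
have vx0 : v x != 0 by rewrite gt_eqF ?abv_gt0.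
by apply: (mulfI vx0); rewrite -abvM !divff ?abv1.
Qed.

Lemma abv_prod (I : Type) (s : seq I) (F : I -> K) :
  v (\prod_(i <- s) F i) = \prod_(i <- s) v (F i).
Proof. exact: (big_morph v (abvM v) abv1). Qed.

Lemma abv_sum (I : Type) (s : seq I) (F : I -> K) :
  v (\sum_(i <- s) F i) <= \sum_(i <- s) v (F i).
Proof.
elim/big_rec2: _ => [|i y x _ IH]; first by rewrite abv0.
by rewrite (le_trans (abvD v _ _))// lerD2l.
Qed.

End AbsValueTheory.

(** * Equicontinuity for the chordal metric *)

Lemma equicontinuous_onP (R : realType) (X : metricType R) (f : X -> X)
    (U : set X) :
  (forall x, U x -> forall eps : R, 0 < eps -> exists2 del : R, 0 < del &
     forall y, mdist x y < del ->
       forall k, mdist (iter k f y) (iter k f x) < eps) ->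
  equicontinuous_on f U.
Proof.
move=> H x Ux eps eps0; have [del del0 Hdel] := H x Ux eps eps0.
have : nbhs x (ball x del) by apply: nbhsx_ballx.
rewrite nbhsE => -[V Vx VB]; exists V => // y /VB.
by rewrite ballEmdist; apply: Hdel.
Qed.

(** The bound h z <= h x + |z - x| keeps h z from outgrowing |z - x|, so that a
    small chordal distance to x forces a small |z - x|; the point at infinity is
    at distance 1 / h x from x. *)
Lemma chordal_small (R : realType) (K : fieldType) (v : absValue R K)
    (h : K -> R) (x : K) (r : R) :
  (forall z, 1 <= h z) -> (forall z w, h z <= h w + v (z - w)) -> 0 < r ->
  exists2 del, 0 < del &
    forall w, chordal v h (Some x) w < del ->
      exists2 z, w = Some z & v (z - x) < r.
Proof.
move=> h1 hD r0; have h0 z : 0 < h z by rewrite (lt_le_trans _ (h1 z)).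
have hx := h0 x; set m := Num.min 1 (r / h x).
have m0 : 0 < m by rewrite lt_min ltr01 divr_gt0.
exists (m / (2 * h x)); first by rewrite divr_gt0// mulr_gt0.
case=> [z|] /=; last first.
  move=> /ltW; rewrite -[leLHS]mul1r invfM mulrA ler_pM2r ?invr_gt0//.
  have : m <= 1 by rewrite ge_min lexx.
  lra.
rewrite abv_distC => H; exists z => //; set d := v (z - x) in H *.
have hz := h0 z; have := hD z x; rewrite -/d => hzd.
have {}H : d < m / 2 * h z.
  move: H; rewrite ltr_pdivrMr ?mulr_gt0//.
  suff -> : m / (2 * h x) * (h x * h z) = m / 2 * h z by [].
  by field; rewrite gt_eqF.
have m1 : m <= 1 by rewrite ge_min lexx.
have mr : m * h x <= r by rewrite -ler_pdivlMr// ge_min lexx orbT.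
have d0 : 0 <= d by apply: abv_ge0.
nra.
Qed.

Lemma iter_polyP1 (K : fieldType) (f : {poly K}) k (z : K) :
  iter k (polyP1 f) (Some z) = Some (iter k (horner f) z).
Proof. by elim: k => //= k ->. Qed.

(** Reduces equicontinuity on a projective line to an estimate on the affine
    line. The map [e] reads off coordinates, so that one proof serves both
    projective lines. *)
Lemma equicontinuous_chordal (R : realType) (K : fieldType)
    (v : absValue R K) (h : K -> R) (f : {poly K}) (X : metricType R)
    (F : X -> X) (S : set X) (U : set K) (e : X -> option K) :
  (forall z, 1 <= h z) -> (forall z w, h z <= h w + v (z - w)) ->
  (forall y z, mdist y z = chordal v h (e y) (e z)) ->
  (forall y, e (F y) = polyP1 f (e y)) ->
  (forall y, S y -> exists2 z, U z & e y = Some z) ->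
  (forall x, U x -> forall eps, 0 < eps -> exists2 r, 0 < r &
     forall z, v (z - x) < r -> forall k,
       chordal v h (Some (iter k (horner f) z))
                   (Some (iter k (horner f) x)) < eps) ->
  equicontinuous_on F S.
Proof.
move=> h1 hD eX eF eS H; apply: equicontinuous_onP => y /eS[x Ux ex] eps eps0.
have [r r0 Hr] := H x Ux eps eps0.
have [del del0 Hdel] := chordal_small x h1 hD r0.
exists del => // z; rewrite eX ex => /Hdel[w ew wx] k.
have eFk u : e (iter k F u) = iter k (polyP1 f) (e u).
  by elim: k => //= k <-.
by rewrite eX !eFk ex ew !iter_polyP1; apply: Hr.
Qed.

Lemma open_ball (R : realType) (T : metricType R) (U : set T) x :
  open U -> U x -> exists2 r : R, 0 < r & forall y, mdist x y < r -> U y.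
Proof.
rewrite openE => oU /oU; rewrite /interior => /nbhs_ballP[r r0 rU].
by exists r => // y xy; apply: rU; rewrite ballEmdist.
Qed.

Lemma orbit_set_omits (T : Type) (f : T -> T) (U A : set T) a :
  orbit_set f U `&` A = set0 -> A a -> forall z k, U z -> iter k f z <> a.
Proof.
move=> UA Aa z k Uz za; have : (orbit_set f U `&` A) a; last by rewrite UA.
by split=> //; exists k => //; exists z.
Qed.

(** * Iterates as polynomials *)

Section Iterates.
Variable K : fieldType.
Implicit Type f : {poly K}.

Definition iter_poly f k : {poly K} := iter k (fun p => f \Po p) 'X.

Lemma horner_iter_poly f k z : (iter_poly f k).[z] = iter k (horner f) z.
Proof. by elim: k => [|k IH]; rewrite /= ?hornerX// horner_comp IH. Qed.

Lemma size_iter_poly f k : (size (iter_poly f k)).-1 = ((size f).-1 ^ k)%N.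
Proof.
elim: k => [|k IH]; first by rewrite size_polyX.
by rewrite /= size_comp_poly IH expnS.
Qed.

End Iterates.

(** * Polynomials without zeros on a disc *)

Section ZeroFree.
Variables (R : realType) (K : closedFieldType) (v : absValue R K).
Implicit Types (g : {poly K}) (x z : K) (r t : R).

Lemma horner_factor g : exists2 s : seq K, size s = (size g).-1 &
  forall z, g.[z] = lead_coef g * \prod_(c <- s) (z - c).
Proof.
have [s gE] := closed_field_poly_normal g.
have [g0|g0] := eqVneq g 0.
  exists [::]; first by rewrite g0 size_poly0.
  by move=> z; rewrite g0 horner0 lead_coef0 mul0r.
exists s => [|z].
  by rewrite gE size_scale ?lead_coef_eq0// size_prod_XsubC.
rewrite {1}gE hornerZ horner_prod; congr (_ * _).
by apply: eq_bigr => c _; rewrite hornerXsubC.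
Qed.

Lemma zero_free_factor g x r : 0 < r ->
  (forall z, v (z - x) < r -> g.[z] != 0) ->
  exists (a : K) (s : seq K), [/\ size s = (size g).-1,
    forall z, g.[z] = a * \prod_(c <- s) (z - c) &
    forall c, c \in s -> r <= v (x - c)].
Proof.
move=> r0 zf; have [s ss gE] := horner_factor g.
exists (lead_coef g), s; split=> // c cs; rewrite leNgt; apply/negP.
rewrite abv_distC => /zf/eqP; apply; rewrite gE (big_rem c)//=.
by rewrite subrr mul0r mulr0.
Qed.

Lemma prod_ratio_le (s : seq K) (F G : K -> R) (q : R) :
  (forall c, c \in s -> 0 <= F c <= G c * q) ->
  \prod_(c <- s) F c <= (\prod_(c <- s) G c) * q ^+ size s.
Proof.
elim: s => [|c s IH] H; first by rewrite !big_nil expr0 mulr1.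
rewrite !big_cons exprS mulrACA ler_pM//.
- by have /andP[] := H c (mem_head _ _).
- rewrite big_seq prodr_ge0// => i si.
  by have /andP[] := H i (mem_behead (s := c :: s) si).
- by have /andP[] := H c (mem_head _ _).
- by apply: IH => i si; apply: H; rewrite inE si orbT.
Qed.

(** Each root is at distance at least r from x, so that
    |z - c| <= |z - x| + |x - c| <= (1 + t) |x - c|. *)
Lemma zero_free_upper g x r t z :
  0 < r -> (forall w, v (w - x) < r -> g.[w] != 0) ->
  v (z - x) <= t * r ->
  v g.[z] <= v g.[x] * (1 + t) ^+ (size g).-1.
Proof.
move=> r0 /(zero_free_factor r0) [a [s [<- gE sr]]] zx.
rewrite !gE !abvM -mulrA ler_wpM2l ?abv_ge0// !abv_prod.
apply: prod_ratio_le => c /sr rc; rewrite abv_ge0/=.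
rewrite -(subrKA x) (le_trans (abvD _ _ _))//.
have : t * r <= t * v (x - c).
  have t0 : 0 <= t by rewrite -(pmulr_lge0 _ r0) (le_trans _ zx) ?abv_ge0.
  exact: ler_wpM2l.
lra.
Qed.

(** The product is a^n - (-u)^n, by the factorization of X^n - 1. *)
Lemma norm_prod_unity n (w a u : K) :
  n.-primitive_root w ->
  v (\prod_(0 <= j < n) (a + u * w ^+ j)) <= v a ^+ n + v u ^+ n.
Proof.
move=> wn; have [->|u0] := eqVneq u 0.
  under eq_bigr do rewrite mul0r addr0.
  by rewrite prodr_const_nat subn0 abvX lerDl exprn_ge0// abv_ge0.
suff -> : \prod_(0 <= j < n) (a + u * w ^+ j) = a ^+ n - (- u) ^+ n.
  by rewrite -(abvN v u) -!abvX abvB.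
have /(congr1 (horner^~ (- a / u))) := factor_Xn_sub_1 wn.
rewrite horner_prod !hornerE => H.
have -> : a ^+ n - (- u) ^+ n = (- u) ^+ n * ((- a / u) ^+ n - 1).
  rewrite mulrBr mulr1 -exprMn; congr (_ ^+ n - _).
  by field.
rewrite -H -[n in (- u) ^+ n]subn0 -prodr_const_nat -big_split/=.
apply: eq_bigr => j _; rewrite hornerXsubC.
by field.
Qed.

(** A multiplicative mean value inequality. For each root c the product of the
    |x + u w^j - c| over j is at most |x - c|^n + |u|^n, and
    |u| <= t r <= t |x - c|. The error 1 + t^n is close to 1 for large n, which
    pointwise upper bounds cannot achieve. *)
Lemma zero_free_mean g x r t u n w :
  0 < r -> (forall w, v (w - x) < r -> g.[w] != 0) ->
  v u <= t * r -> n.-primitive_root w ->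
  \prod_(0 <= j < n) v g.[x + u * w ^+ j] <=
    v g.[x] ^+ n * (1 + t ^+ n) ^+ (size g).-1.
Proof.
move=> r0 /(zero_free_factor r0) [a [s [<- gE sr]]] ut wn.
rewrite gE abvM exprMn -mulrA.
under eq_bigr do rewrite gE abvM.
rewrite big_split/= prodr_const_nat subn0 ler_wpM2l ?exprn_ge0 ?abv_ge0//.
rewrite -abv_prod exchange_big/= !abv_prod -prodrXl.
apply: prod_ratio_le => c cs; rewrite abv_ge0/=.
under eq_bigr do rewrite addrAC.
apply: le_trans (norm_prod_unity _ _ wn) _.
rewrite mulrDr mulr1 lerD2l -exprMn lerXn2r ?nnegrE ?abv_ge0//.
  rewrite mulr_ge0 ?abv_ge0//.
  by rewrite -(pmulr_lge0 _ r0) (le_trans _ ut) ?abv_ge0.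
rewrite (le_trans ut)// mulrC ler_wpM2r ?sr//.
by rewrite -(pmulr_lge0 _ r0) (le_trans _ ut) ?abv_ge0.
Qed.

End ZeroFree.

(** * The non-Archimedean case *)

Section NonArch.
Variables (R : realType) (K : closedFieldType) (v : nonArchAbs R K).

Local Notation h := (@nanorm1 R K v).

Definition nonarch_absValue : absValue R K :=
  AbsValue (na_ge0 v) (na_eq0 v) (na_M v) (na_leD v).

(** By induction on the number of factors: in
    (z - c) P - (x - c) Q = (z - c) (P - Q) + (z - x) Q both terms are at most
    t |x - c| |Q|, and the ultrametric inequality takes their maximum. This is
    why the constant does not depend on the degree. *)
Lemma zero_free_lipschitz (g : {poly K}) (x z : K) (r t : R) : 0 < r ->
  (forall w, v (w - x) < r -> g.[w] != 0) ->
  v (z - x) <= t * r -> t <= 1 ->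
  v (g.[z] - g.[x]) <= t * v g.[x].
Proof.
move=> r0 zf zx t1.
have t0 : 0 <= t by rewrite -(pmulr_lge0 _ r0) (le_trans _ zx) ?na_ge0.
have [a [s [_ gE sr]]] := @zero_free_factor _ _ nonarch_absValue g x r r0 zf.
rewrite !gE -mulrBr !na_M mulrCA ler_wpM2l ?na_ge0//.
elim: s sr {gE} => [|c s IH] sr.
  by rewrite !big_nil subrr na_abs0 mulr_ge0 ?na_ge0.
have rc := sr c (mem_head _ _).
have tr : t * r <= t * v (x - c) by rewrite ler_wpM2l.
have zc : v (z - c) <= v (x - c).
  rewrite -(subrKA x) (le_trans (na_D v _ _))// ge_max lexx andbT.
  by rewrite (le_trans zx)// (le_trans tr)// ler_piMl ?na_ge0.
rewrite !big_cons; set P := \prod_(_ <- s) _; set Q := \prod_(_ <- s) _.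
have {}IH : v (P - Q) <= t * v Q by apply: IH => i si; rewrite sr// inE si orbT.
have -> : (z - c) * P - (x - c) * Q = (z - c) * (P - Q) + (z - x) * Q by ring.
rewrite (le_trans (na_D v _ _))// !na_M ge_max mulrCA; apply/andP; split.
  by rewrite ler_pM ?na_ge0.
by rewrite mulrA ler_wpM2r ?na_ge0// (le_trans zx)// [leRHS]mulrC.
Qed.

(** The bound |F_k x - alpha| <= ||F_k x|| ||alpha|| turns the previous estimate
    into one for the chordal distance. *)
Lemma nonarch_equicontinuous (f : {poly K}) (x alpha : K) (r eps : R) :
  0 < r ->
  (forall z, v (z - x) < r -> forall k, iter k (horner f) z != alpha) ->
  0 < eps -> exists2 s, 0 < s &
    forall z, v (z - x) < s -> forall k,
      chordal v h (Some (iter k (horner f) z))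
        (Some (iter k (horner f) x)) < eps.
Proof.
move=> r0 omit eps0; set M := h alpha.
have M0 : 0 < M by apply: nanorm1_gt0.
set t := Num.min 1 (eps / (2 * M)).
have t0 : 0 < t by rewrite lt_min ltr01 divr_gt0// mulr_gt0.
exists (t * r); first by rewrite mulr_gt0.
move=> z zx k /=; set a := iter k _ z; set b := iter k _ x.
have lip : v (a - b) <= t * v (b - alpha).
  have := @zero_free_lipschitz (iter_poly f k - alpha%:P) x z r t r0.
  rewrite !hornerE !horner_iter_poly opprD addrACA opprK addNr addr0; apply.
  - by move=> w wx; rewrite !hornerE horner_iter_poly subr_eq0; apply: omit.
  - exact: ltW.
  - by rewrite ge_min lexx.
have bM : v (b - alpha) <= h b * M.
  have ge1 (c : K) : 1 <= h c by rewrite le_max lexx.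
  rewrite (le_trans (na_D v _ _))// na_absN ge_max; apply/andP; split.
    rewrite (le_trans (@norm_le_nanorm1 _ _ v b))// ler_peMr ?ge1//.
    by rewrite nanorm1_ge0.
  apply: le_trans (@norm_le_nanorm1 _ _ v alpha) _; rewrite ler_peMl ?ge1//.
  exact: ltW.
have a1 : 1 <= h a by rewrite le_max lexx.
have b0 : 0 < h b by apply: nanorm1_gt0.
rewrite ltr_pdivrMr ?mulr_gt0 ?nanorm1_gt0//.
have tM : t * M < eps.
  have : t * (2 * M) <= eps.
    by rewrite -ler_pdivlMr ?mulr_gt0// ge_min lexx orbT.
  lra.
apply: le_lt_trans (_ : t * M * h b < _).
  by rewrite (le_trans lip)// -mulrA ler_pM2l// mulrC.
apply: lt_le_trans (_ : eps * h b <= _); first by rewrite ltr_pM2r.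
by rewrite ler_pM2l// ler_peMl// ltW.
Qed.

End NonArch.

(** * Roots of unity and Cauchy estimates *)

Lemma prim_root_exists (K : closedFieldType) n :
  n%:R != 0 :> K -> exists w : K, n.-primitive_root w.
Proof.
move=> nK; have n0 : (0 < n)%N by case: n nK => //; rewrite eqxx.
have [s sE] := closed_field_poly_normal ('X^n - 1 : {poly K}).
rewrite (monicP _) ?monicXnsubC// scale1r in sE.
have s1 : all n.-unity_root s by apply/allP => z; rewrite -root_prod_XsubC -sE.
have ss : (n < (size s).+1)%N.
  by rewrite -(size_prod_XsubC s id) -sE size_XnsubC.
have us : uniq s by rewrite -separable_prod_XsubC -sE separable_Xn_sub_1.
by have /hasP[w _ wn] := has_prim_root n0 s1 us ss; exists w.
Qed.

(** The hypothesis [v_nat] is what makes the absolute value Archimedean. It puts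
    K in characteristic 0, so that K has primitive roots of unity of all orders,
    and it makes averages of n terms obey the bound on the terms. *)
Section CauchyEstimates.
Variables (R : realType) (K : closedFieldType) (v : absValue R K).
Hypothesis v_nat : forall n : nat, v n%:R = n%:R.

Lemma natr_neq0 n : (0 < n)%N -> n%:R != 0 :> K.
Proof.
move=> n0; apply/eqP => nK; have := v_nat n; rewrite nK abv0 => /esym/eqP.
by rewrite pnatr_eq0 -(negbK (n == 0)%N) -lt0n n0.
Qed.

(** For n larger than the degree and than i, the coefficient q_i is the average
    over the n-th roots of unity w of q(w) w^-i. *)
Lemma cauchy_coef (q : {poly K}) (M : R) :
  (forall w, v w = 1 -> v q.[w] <= M) -> forall i, v q`_i <= M.
Proof.
move=> qM i; set n := (maxn (size q) i).+1.
have M0 : 0 <= M by rewrite (le_trans (abv_ge0 v q.[1])) ?qM ?abv1.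
have n0 : (0 < n)%N by [].
have [w wn] := prim_root_exists (natr_neq0 n0).
have w0 : w != 0.
  apply/eqP => w0; have /eqP := prim_expr_order wn.
  by rewrite w0 expr0n eq_sym oner_eq0.
have vw j : v (w ^+ j) = 1.
  by rewrite abvX (abv_unity v n0 (prim_expr_order wn)) expr1n.
have geom (l : nat) : (l < n)%N -> l != i ->
    \sum_(0 <= j < n) (w ^+ l / w ^+ i) ^+ j = 0.
  move=> ln li; have wli : w ^+ l / w ^+ i != 1.
    apply/eqP => /(congr1 (fun z => z * w ^+ i)).
    rewrite mulfVK ?expf_neq0// mul1r => /eqP.
    rewrite (eq_prim_root_expr wn) !modn_small ?(negbTE li)//.
    by rewrite ltnS leq_maxr.
  apply: (mulfI (_ : (w ^+ l / w ^+ i) - 1 != 0)); first by rewrite subr_eq0.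
  rewrite mulr0 big_mkord -subrX1 expr_div_n -!exprM mulnC [(i * n)%N]mulnC.
  by rewrite !exprM (prim_expr_order wn) !expr1n divr1 subrr.
have wE (j l : nat) : (w ^+ j) ^+ l * (w ^+ i) ^- j = (w ^+ l / w ^+ i) ^+ j.
  by rewrite expr_div_n -!exprM mulnC.
have key : \sum_(0 <= j < n) q.[w ^+ j] * (w ^+ i) ^- j = q`_i *+ n.
  under eq_bigr => j _.
    rewrite (@horner_coef_wide _ n); last by rewrite leqW// leq_maxl.
    rewrite mulr_suml.
    under eq_bigr => l _.
      rewrite -mulrA wE; over.
    over.
  rewrite exchange_big/=.
  have i_n : (i < n)%N by rewrite ltnS leq_maxr.
  rewrite (bigD1 (Ordinal i_n))//= [X in _ + X]big1 ?addr0; last first.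
    by move=> l li; rewrite -mulr_sumr geom ?mulr0.
  rewrite -mulr_sumr divff ?expf_neq0//.
  under eq_bigr do rewrite expr1n.
  by rewrite sumr_const_nat subn0 mulr_natr.
have : v (q`_i *+ n) <= M *+ n.
  rewrite -key (le_trans (abv_sum _ _ _))//.
  rewrite -[n in leRHS]subn0 -sumr_const_nat ler_sum// => j _.
  by rewrite abvM -exprM abvV vw invr1 mulr1 qM.
by rewrite -mulr_natr abvM v_nat mulr_natr lerMn2r.
Qed.

(** The Schwarz-type estimate along the direction u. Rescaling by the integer m,
    whose absolute value is m, avoids having to find a scalar with a prescribed
    absolute value: with q(T) = p(x + m u T), the points x and x + u are T = 0
    and T = 1/m. *)
Lemma bounded_poly_lipschitz (p : {poly K}) (x u : K) (M : R) (m : nat) :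
  (1 < m)%N -> (forall z, v (z - x) <= m%:R * v u -> v p.[z] <= M) ->
  v (p.[x + u] - p.[x]) <= 2 * M / m%:R.
Proof.
move=> m1 pM; pose q := p \Po (x%:P + (m%:R * u)%:P * 'X).
have qE w : q.[w] = p.[x + m%:R * u * w].
  by rewrite horner_comp !hornerE.
have qc : forall i, v q`_i <= M.
  apply: cauchy_coef => w w1.
  by rewrite qE pM// addrC addKr !abvM w1 mulr1 v_nat.
have m0 : m%:R != 0 :> K by rewrite natr_neq0// ltnW.
have -> : p.[x + u] = q.[m%:R^-1] by rewrite qE mulrAC divff// mul1r.
have -> : p.[x] = q.[0] by rewrite qE mulr0 addr0.
have M0 : 0 <= M := le_trans (abv_ge0 v _) (qc 0%N).
have mR : (0 : R) < m%:R by rewrite ltr0n ltnW.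
set y : R := m%:R^-1.
have y0 : 0 <= y by rewrite invr_ge0 ltW.
have y2 : 2 * y <= 1 by rewrite /y ler_pdivrMr// mul1r ler_nat.
rewrite horner_coef0 (@horner_coef_wide _ (size q).+1) ?leqW//.
rewrite big_ord_recl/= expr0 mulr1 addrC addKr.
rewrite (le_trans (abv_sum _ _ _))//.
apply: le_trans (_ : \sum_(i < size q) M * y * y ^+ i <= _).
  apply: ler_sum => i _; rewrite abvM abvX abvV v_nat -/y -mulrA -exprS.
  by rewrite ler_wpM2r ?exprn_ge0.
rewrite -mulr_sumr.
have S2 : \sum_(i < size q) y ^+ i <= 2.
  have := subrX1 y (size q); set S := \sum_(i < _) _ => SE.
  have yn : 0 <= y ^+ size q by rewrite exprn_ge0.
  have S0 : 0 <= S by rewrite sumr_ge0// => i _; rewrite exprn_ge0.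
  have := ler_wpM2r S0 y2; rewrite -mulrA !mul1r => H.
  rewrite mulrBl mul1r in SE.
  move: SE yn H; clear -S; set a := y * S; set c := y ^+ _; lra.
have -> : 2 * M / m%:R = M * y * 2 by rewrite /y; ring.
by rewrite ler_wpM2l// mulr_ge0.
Qed.

(** The radius s is chosen before the polynomial: polynomials with a common
    bound on a disc are equicontinuous at its centre. *)
Lemma bounded_equicontinuous (M r eps : R) : 0 < r -> 0 < eps ->
  exists2 s, 0 < s & forall (p : {poly K}) x,
    (forall z, v (z - x) < r -> v p.[z] <= M) ->
    forall z, v (z - x) < s -> v (p.[z] - p.[x]) < eps.
Proof.
move=> r0 eps0.
have [m m1 mM] : exists2 m, (1 < m)%N & 2 * M < eps * m%:R.
  near \oo => m; exists m; first by near: m; exact: nbhs_infty_gt.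
  by rewrite -ltr_pdivrMl//; near: m; exact: nbhs_infty_gtr.
have m0 : (0 : R) < m%:R by rewrite ltr0n ltnW.
exists (r / m%:R) => [|p x pM z zx]; first by rewrite divr_gt0.
have := @bounded_poly_lipschitz p x (z - x) M m m1.
rewrite [x + _]addrC subrK => H; apply: (@le_lt_trans _ _ (2 * M / m%:R)).
  apply: H => w wx; apply: pM; apply: le_lt_trans wx _.
  by rewrite mulrC -ltr_pdivlMr.
by rewrite ltr_pdivrMr.
Unshelve. all: by end_near. Qed.

Lemma poly_abv_continuous (p : {poly K}) (x : K) (eps : R) : 0 < eps ->
  exists2 s, 0 < s & forall z, v (z - x) < s -> v (p.[z] - p.[x]) < eps.
Proof.
move=> eps0; pose M := \sum_(i < size p) v p`_i * (1 + v x) ^+ i.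
have [s s0 H] := bounded_equicontinuous M ltr01 eps0.
exists s => // z zx; apply: H zx => {}z zx.
rewrite horner_coef (le_trans (abv_sum _ _ _))// ler_sum// => i _.
rewrite abvM abvX ler_wpM2l ?abv_ge0// lerXn2r ?nnegrE ?addr_ge0 ?abv_ge0//.
have := abv_leB v z x; lra.
Qed.

End CauchyEstimates.

(** * Escaping orbits *)

(** Far from the origin |f z| is comparable to |z|^d. So there an orbit grows
    like the d^j-th power of its starting point, the exact rate that makes
    ln |F_k| / d^k bounded below by a positive constant. *)
Lemma escape_radius (R : realType) (K : closedFieldType) (v : absValue R K)
    (f : {poly K}) : (1 < (size f).-1)%N ->
  exists rho : R,
    (forall z, rho <= v z -> rho < v f.[z]) /\
    (forall z, rho <= v z -> forall j,
        2 ^+ ((size f).-1 ^ j) <= v (iter j (horner f) z)).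
Proof.
set d := (size f).-1 => d1.
have [s ss fE] := horner_factor f.
have f0 : lead_coef f != 0.
  by rewrite lead_coef_eq0 -size_poly_eq0 -lt0n ltnW// -ltn_predRL ltnW.
pose S := \sum_(c <- s) v c.
have S0 : 0 <= S by rewrite sumr_ge0// => c _; exact: abv_ge0.
have cS c : c \in s -> v c <= S.
  move=> cs; rewrite /S (big_rem c)//= lerDl sumr_ge0// => i _; exact: abv_ge0.
(* With this b, the bound |f z| >= |c| (|z|/2)^d for large |z|, where c is the
   leading coefficient, takes the form (b |z|)^d <= b |f z|, which iterates. *)
pose b := Num.min 1 (v (lead_coef f) / 2 ^+ d).
have b0 : 0 < b by rewrite lt_min ltr01 divr_gt0 ?abv_gt0 ?exprn_gt0.
have b1 : b <= 1 by rewrite ge_min lexx.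
have grow z : 2 * S <= v z -> (b * v z) ^+ d <= b * v f.[z].
  move=> Sz; have fz : (v z / 2) ^+ d * v (lead_coef f) <= v f.[z].
    rewrite fE abvM mulrC ler_wpM2l ?abv_ge0// abv_prod /d -ss -prod_const_seq.
    rewrite [leLHS]big_seq [leRHS]big_seq; apply: ler_prod => c cs.
    rewrite divr_ge0 ?abv_ge0//=.
    have := abv_leB v z c; have := cS c cs; lra.
  have bd : b ^+ d <= b * (v (lead_coef f) / 2 ^+ d).
    apply: le_trans (_ : b ^+ 2 <= _).
      by rewrite ler_wiXn2l ?(ltW b0).
    by rewrite expr2 ler_wpM2l ?(ltW b0)// /b ge_min lexx orbT.
  rewrite exprMn (le_trans (ler_wpM2r _ bd)) ?exprn_ge0 ?abv_ge0//.
  rewrite -mulrA ler_wpM2l ?(ltW b0)//.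
  by rewrite (le_trans _ fz)// expr_div_n mulrAC -mulrA mulrC.
pose rho := 2 / b + 2 * S.
have rho_b z : rho <= v z -> 2 <= b * v z.
  move=> rz; rewrite mulrC -ler_pdivrMr// (le_trans _ rz)// lerDl; lra.
have rho_S z : rho <= v z -> 2 * S <= v z.
  by move=> rz; rewrite (le_trans _ rz)// lerDr divr_ge0// ltW.
have rho0 : 1 <= rho.
  have : 2 <= 2 / b by rewrite ler_pdivlMr// ler_piMr.
  rewrite /rho; lra.
have rho_f z : rho <= v z -> rho < v f.[z].
  move=> rz; have bz := rho_b _ rz; have := grow z (rho_S _ rz).
  have : (b * v z) ^+ 2 <= (b * v z) ^+ d by rewrite ler_weXn2l//; lra.
  have vz : 0 < v z by lra.
  move=> h1 h2; have : b * (2 * v z) <= b * v f.[z].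
    have bz0 : 0 <= b * v z by lra.
    have := ler_wpM2r bz0 bz; have := le_trans h1 h2; rewrite expr2; lra.
  rewrite ler_pM2l//; lra.
exists rho; split=> // z rz j.
suff : rho <= v (iter j (horner f) z) /\
    2 ^+ (d ^ j) <= b * v (iter j (horner f) z).
  case=> _ /le_trans; apply; rewrite ler_piMl ?abv_ge0//.
elim: j => [|j [rj IH]]; first by rewrite expn0 expr1; split=> //; exact: rho_b.
rewrite iterS; split; first exact/ltW/rho_f.
rewrite (le_trans _ (grow _ (rho_S _ rj)))// expnSr exprM.
by rewrite lerXn2r ?nnegrE ?exprn_ge0// (le_trans _ IH)// exprn_ge0.
Qed.

(** * The omitted values form an infinite set *)

(** In a finite backward invariant set each point has exactly one preimage, so
    f is totally ramified over it: f - c is a multiple of (X - c')^d. Then c' is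
    the only critical point of f, the same for all c in the set, which leaves
    room for just one c. *)
Lemma backward_invariant_infinite (K : closedFieldType) (f : {poly K})
    (E : set K) (alpha beta : K) :
  (1 < (size f).-1)%N -> (size f).-1%:R != 0 :> K ->
  (forall w, E f.[w] -> E w) -> E alpha -> E beta -> alpha != beta ->
  infinite_set E.
Proof.
set d := (size f).-1 => d1 dK Einv Ea Eb ab /finite_seqP[s Es].
have sf : (2 < size f)%N by rewrite -ltn_predRL.
have sc c : (size (- c%:P : {poly K}) < size f)%N.
  by rewrite size_polyN (leq_ltn_trans (size_polyC_leq1 _))// ltnW.
have f1 c : size (f - c%:P) = size f by rewrite size_polyDl.
have f0 : lead_coef f != 0 by rewrite lead_coef_eq0 -size_poly_gt0 2?ltnW.
have root_ex c : exists w, root (f - c%:P) w.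
  by apply/closed_rootP; rewrite f1 gtn_eqF// ltnW.
pose g c := xchoose (root_ex c).
have fg c : f.[g c] = c.
  have := xchooseP (root_ex c); rewrite rootE !hornerE subr_eq0.
  by move/eqP.
have memE c : (c \in s) <-> E c by rewrite Es.
have gs : {subset map g (undup s) <= undup s}.
  move=> _ /mapP[c + ->]; rewrite !mem_undup => /memE Ec.
  by apply/memE/Einv; rewrite fg.
have ug : uniq (map g (undup s)).
  rewrite map_inj_uniq ?undup_uniq// => x y /(congr1 (horner f)).
  by rewrite !fg.
(* The injection g maps the finite set E into itself, hence onto itself, so each
   c in E has g c as its only preimage. *)
have [_ gsE] := uniq_min_size ug gs (eq_leq (esym (size_map _ _))).
have only_root c w : E c -> f.[w] = c -> w = g c.
  move=> Ec fw; have : w \in undup s.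
    by rewrite mem_undup; apply/memE/Einv; rewrite fw.
  by rewrite -gsE => /mapP[y _ wy]; rewrite -fw wy fg.
have fE c : E c -> f - c%:P = lead_coef f *: ('X - (g c)%:P) ^+ d.
  move=> Ec; have [t tE] := closed_field_poly_normal (f - c%:P).
  have lE : lead_coef (f - c%:P) = lead_coef f.
    by rewrite lead_coefDl.
  have st : size t = d.
    by rewrite /d -(f1 c) tE size_scale ?lE// size_prod_XsubC.
  rewrite tE lE; congr (_ *: _); rewrite -st big_seq.
  rewrite (eq_bigr (fun=> 'X - (g c)%:P)); last first.
    move=> w wt; congr (_ - _%:P); apply: only_root => //.
    have : root (f - c%:P) w.
      by rewrite tE lE rootZ// root_prod_XsubC.
    by rewrite rootE !hornerE subr_eq0 => /eqP.
  by rewrite -big_seq prod_const_seq.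
(* The only root of f' is g c. Taking c = alpha and c = beta gives
   g alpha = g beta, hence alpha = beta. *)
have f'E c : E c -> f^`() = lead_coef f *: (('X - (g c)%:P) ^+ d.-1 *+ d).
  move=> Ec; have /(congr1 (@deriv K)) := fE c Ec.
  by rewrite derivB derivC subr0 derivZ deriv_exp derivXsubC mul1r.
have := f'E _ Ea; rewrite (f'E _ Eb) => /(congr1 (horner^~ (g alpha))).
rewrite !hornerE !hornerMn !horner_exp !hornerXsubC subrr expr0n.
have -> : (d.-1 == 0)%N = false by case: (d) d1 => [|[|]].
rewrite mul0rn mulr0 => /eqP; rewrite mulf_eq0 (negbTE f0)/= -mulr_natr.
rewrite mulf_eq0 (negbTE dK) orbF expf_eq0 subr_eq0 => /andP[_ /eqP gab].
by move/eqP: ab; apply; rewrite -(fg alpha) gab fg.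
Qed.

(** * The potentials ln |F_k z - a| / d^k *)

Section LogZeroFree.
Variables (R : realType) (K : closedFieldType) (v : absValue R K).
Implicit Types (g : {poly K}) (x z : K) (r t : R).

Lemma ln_zero_free_upper g x r t z :
  0 < r -> (forall w, v (w - x) < r -> g.[w] != 0) ->
  v (z - x) <= t * r -> g.[z] != 0 ->
  ln (v g.[z]) <= ln (v g.[x]) + t *+ (size g).-1.
Proof.
move=> r0 zf zx gz.
have t0 : 0 <= t by rewrite -(pmulr_lge0 _ r0) (le_trans _ zx) ?abv_ge0.
have gx : g.[x] != 0 by rewrite zf// subrr abv0.
have := zero_free_upper r0 zf zx.
rewrite -ler_ln ?posrE ?mulr_gt0 ?exprn_gt0 ?abv_gt0//; try by lra.
rewrite lnM ?posrE ?exprn_gt0 ?abv_gt0//; try by lra.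
rewrite lnXn; last by lra.
move/le_trans; apply; rewrite lerD2l lerMn2r le_ln1Dx ?orbT//.
lra.
Qed.

Lemma ln_zero_free_mean g x r t u n w :
  0 < r -> (forall w, v (w - x) < r -> g.[w] != 0) ->
  v u <= t * r -> t < 1 -> n.-primitive_root w ->
  \sum_(0 <= j < n) ln (v g.[x + u * w ^+ j]) <=
    ln (v g.[x]) *+ n + t ^+ n *+ (size g).-1.
Proof.
move=> r0 zf ut t1 wn.
have t0 : 0 <= t by rewrite -(pmulr_lge0 _ r0) (le_trans _ ut) ?abv_ge0.
have tn : 0 <= t ^+ n by rewrite exprn_ge0.
have gx : g.[x] != 0 by rewrite zf// subrr abv0.
have n0 := prim_order_gt0 wn.
have gw j : 0 < v g.[x + u * w ^+ j].
  rewrite abv_gt0// zf// addrC addKr abvM abvX.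
  rewrite (abv_unity v n0 (prim_expr_order wn)) expr1n mulr1.
  by rewrite (le_lt_trans ut)// gtr_pMl.
have := zero_free_mean r0 zf ut wn.
rewrite -ln_prod// -ler_ln ?posrE; last 2 first.
- by rewrite prodr_gt0.
- by rewrite mulr_gt0 ?exprn_gt0 ?abv_gt0//; lra.
rewrite lnM ?posrE ?exprn_gt0 ?abv_gt0//; last by lra.
rewrite !lnXn ?abv_gt0//; last by lra.
move/le_trans; apply; rewrite lerD2l lerMn2r le_ln1Dx ?orbT//.
lra.
Qed.

End LogZeroFree.

Section LogIterate.
Variables (R : realType) (K : closedFieldType) (v : absValue R K).
Hypothesis v_nat : forall n : nat, v n%:R = n%:R.
Variable f : {poly K}.
Local Notation d := (size f).-1.
Hypothesis d1 : (1 < d)%N.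
Local Notation F k := (iter k (horner f)).

Definition log_iter (a : K) (k : nat) (z : K) : R :=
  ln (v (F k z - a)) / (d ^ k)%:R.

Let dk_gt0 k : (0 : R) < (d ^ k)%:R.
Proof. by rewrite ltr0n expn_gt0 ltnW. Qed.

Lemma size_iter_polyB a k : (size (iter_poly f k - a%:P)).-1 = (d ^ k)%N.
Proof.
rewrite size_polyDl ?size_iter_poly// size_polyN.
rewrite (leq_ltn_trans (size_polyC_leq1 _))// -ltn_predRL size_iter_poly.
by rewrite expn_gt0 ltnW.
Qed.

Let iter_polyB a k z : (iter_poly f k - a%:P).[z] = F k z - a.
Proof. by rewrite !hornerE horner_iter_poly. Qed.

Let log_iterE a k z : log_iter a k z * (d ^ k)%:R = ln (v (F k z - a)).
Proof. by rewrite /log_iter mulfVK// gt_eqF. Qed.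

(** Harnack's inequality. The division by d^k compensates for the number of
    roots, so the bound does not depend on k. *)
Lemma log_iter_upper a k x r t z :
  0 < r -> (forall w, v (w - x) < r -> F k w != a) ->
  v (z - x) <= t * r -> F k z != a ->
  log_iter a k z <= log_iter a k x + t.
Proof.
move=> r0 zf zx za; rewrite -(ler_pM2r (dk_gt0 k)) mulrDl !log_iterE.
have := @ln_zero_free_upper _ _ v (iter_poly f k - a%:P) x r t z r0.
rewrite !iter_polyB size_iter_polyB mulr_natr; apply=> //.
- by move=> w wx; rewrite iter_polyB subr_eq0 zf.
- by rewrite subr_eq0.
Qed.

(** The error t^n does not depend on k, and it is small compared with any
    positive lower bound of a single term once n is large. *)
Lemma log_iter_mean a k x r t u n w :
  0 < r -> (forall w, v (w - x) < r -> F k w != a) ->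
  v u <= t * r -> t < 1 -> n.-primitive_root w ->
  \sum_(0 <= j < n) log_iter a k (x + u * w ^+ j) <=
    log_iter a k x *+ n + t ^+ n.
Proof.
move=> r0 zf ut t1 wn; rewrite -(ler_pM2r (dk_gt0 k)) mulrDl mulr_suml.
pose g := iter_poly f k - a%:P.
rewrite (eq_bigr (fun j => ln (v g.[x + u * w ^+ j]))); last first.
  by move=> j _; rewrite log_iterE iter_polyB.
rewrite mulrnAl log_iterE -iter_polyB mulr_natr -(size_iter_polyB a k).
apply: (ln_zero_free_mean r0) => // y yx.
by rewrite iter_polyB subr_eq0 zf.
Qed.

Lemma degree_large (b c : R) :
  0 < c -> \forall k \near \oo, b <= c * (d ^ k)%:R.
Proof.
move=> c0; near=> k; rewrite -ler_pdivrMl//.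
apply: (@le_trans _ _ k%:R); last by rewrite ler_nat ltnW// ltn_expl.
by near: k; exact: nbhs_infty_ger.
Unshelve. all: by end_near. Qed.

Lemma log_iter_bounded a x (M c : R) :
  (forall k, F k x != a) -> (forall k, v (F k x) <= M) -> 0 < c ->
  \forall k \near \oo, log_iter a k x <= c.
Proof.
move=> xa xM c0; near=> k.
rewrite ler_pdivrMr//.
have H : 0 < v (F k x - a) by rewrite abv_gt0// subr_eq0.
apply: (@le_trans _ _ (M + v a)).
  rewrite (le_trans (ltW (ln_sublinear H)))//.
  by rewrite (le_trans (abvB _ _ _))// lerD2r.
by near: k; exact: degree_large.
Unshelve. all: by end_near. Qed.

(** G does not depend on a: once F_k y is large, subtracting a at most halves
    it. *)
Lemma log_iter_escaping y k0 :
  (forall j, 2 ^+ (d ^ j) <= v (F (j + k0) y)) ->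
  exists2 G : R, 0 < G & forall a, \forall k \near \oo, G <= log_iter a k y.
Proof.
move=> esc; have ln2 : (0 : R) < ln 2 by rewrite ln_gt0// ltr1n.
exists (ln 2 / 2 / (d ^ k0)%:R) => [|a]; first by rewrite !divr_gt0.
near=> k.
have k0k : (k0 <= k)%N by near: k; exact: nbhs_infty_ge.
have := esc (k - k0)%N; rewrite subnK//; set j := (k - k0)%N.
have jE : (d ^ k)%:R = (d ^ j)%:R * (d ^ k0)%:R :> R.
  by rewrite -natrM -expnD subnK.
set p : R := 2 ^+ _ => yp.
have dj : 2 + 2 * v a <= (d ^ j)%:R.
  rewrite -(ler_pM2r (dk_gt0 k0)) -jE -[leRHS]mul1r.
  near: k; exact: degree_large.
have pj : (d ^ j)%:R <= p by rewrite /p -natrX ler_nat ltnW// ltn_expl.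
have va := abv_ge0 v a.
have yB := abv_leB v (F k y) a.
have p2 : p / 2 <= v (F k y - a) by lra.
have p0 : 0 < p by rewrite exprn_gt0.
have : ln (p / 2) <= ln (v (F k y - a)).
  by rewrite ler_ln ?posrE ?divr_gt0// (lt_le_trans _ p2)// divr_gt0.
rewrite ln_div ?posrE// lnXn// -[ln 2 *+ _]mulr_natr => H.
rewrite ler_pdivlMr// jE (mulrC (d ^ j)%:R) mulrA divfK ?gt_eqF//.
apply: le_trans H.
move: dj; move: (d ^ j)%:R => D dj.
have : 2 * ln 2 <= D * ln 2 by rewrite ler_pM2r//; lra.
lra.
Unshelve. all: by end_near. Qed.

Lemma separated_seq (s : seq K) : exists2 del : R, 0 < del <= 1 &
  forall a b, a \in s -> b \in s -> a != b -> 2 * del <= v (a - b).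
Proof.
have : \forall del \near 0^'+, forall a, a \in s -> forall b, b \in s ->
    a != b -> 2 * del <= v (a - b).
  apply: near_in_seq => a sa; apply: near_in_seq => b sb.
  have [->|ab] := eqVneq a b; first by near=> del.
  near=> del => _; rewrite mulrC -ler_pdivlMr//; near: del.
  by apply: nbhs_right_le; rewrite divr_gt0// abv_gt0// subr_eq0.
have : \forall del \near (0 : R)^'+, 0 < del <= 1.
  near=> del; apply/andP; split; first by near: del; exact: nbhs_right_gt.
  by near: del; exact: nbhs_right_le.
move=> /filterI/[apply]/filter_ex[del [del01 H]].
by exists del => // a b sa sb; apply: H.
Unshelve. all: by end_near. Qed.

(** Otherwise x is a point with a bounded orbit and with escaping points y
    arbitrarily near it. The contradiction is the one between the mean value
    inequality and the positivity of the potential at y, for the average of the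
    potentials over a large finite set s of omitted values. The constants are
    chosen in the order y, G, n, s, k. *)
Lemma omitted_orbit_normal (E : set K) (x : K) (r M : R) :
  0 < r -> infinite_set E ->
  (forall a, E a -> forall k z, v (z - x) < r -> F k z != a) ->
  (forall k, v (F k x) <= M) ->
  exists2 s, 0 < s & forall y k0, v (y - x) < s ->
    ~ (forall j, 2 ^+ (d ^ j) <= v (F (j + k0) y)).
Proof.
move=> r0 Einf omit xM; apply: contrapT => noS.
have escaping s : 0 < s -> exists y k0, v (y - x) < s /\
    (forall j, 2 ^+ (d ^ j) <= v (F (j + k0) y)).
  move=> s0; apply: contrapT => H; apply: noS; exists s => // y k0 yx esc.
  by apply: H; exists y, k0.
have omit_x a k : E a -> F k x != a by move=> Ea; rewrite omit// subrr abv0.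
(* Harnack between x and an escaping point at distance less than t r, where the
   potential is eventually positive. The point depends on c, and so does the
   range of k. *)
have log_x a c : E a -> 0 < c -> \forall k \near \oo, - c <= log_iter a k x.
  move=> Ea c0; pose t := Num.min c (1 / 2).
  have t0 : 0 < t by rewrite lt_min c0/=; lra.
  have t1 : t <= 1 / 2 by rewrite ge_min lexx orbT.
  have tc : t <= c by rewrite ge_min lexx.
  have [y [k0 [yx esc]]] := escaping (t * r) (mulr_gt0 t0 r0).
  have [G G0 HG] := log_iter_escaping esc.
  near=> k.
  have Gy : G <= log_iter a k y by near: k; exact: HG.
  have : log_iter a k y <= log_iter a k x + t.
    apply: (log_iter_upper r0 _ (ltW yx)); first by move=> w; apply: omit.
    apply: omit => //; rewrite (lt_trans yx)// gtr_pMl//; lra.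
  lra.
(* Harnack again, now from z to x: the disc of centre z and radius r/2 lies in
   the zero-free disc of x. *)
have log_z a z : E a -> v (z - x) < r / 2 ->
    \forall k \near \oo, - 2 <= log_iter a k z.
  move=> Ea zx; near=> k.
  have : - 1 <= log_iter a k x by near: k; apply: log_x.
  have : log_iter a k x <= log_iter a k z + 1.
    apply: (@log_iter_upper a k z (r / 2)) => //; first lra.
    - move=> w wz; apply: omit => //.
      have := abvD v (w - z) (z - x); rewrite subrKA; lra.
    - by rewrite abv_distC mul1r ltW.
    - exact: omit_x.
  lra.
have r20 : 0 < r / 2 by lra.
have [y [k0 [yx esc]]] := escaping _ r20.
have [G G0 HG] := log_iter_escaping esc.
pose u := y - x; pose t := v u / r.
have ut : v u <= t * r by rewrite /t mulfVK// gt_eqF.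
have t12 : t <= 1 / 2 by rewrite ler_pdivrMr// /u; lra.
have t0 : 0 <= t by rewrite divr_ge0 ?abv_ge0// ltW.
have [n tn] : exists n, t ^+ n.+1 <= G / 4.
  near \oo => n; exists n.
  apply: (@le_trans _ _ ((1 / 2) ^+ n.+1)).
    by rewrite lerXn2r// nnegrE//; lra.
  rewrite expr_div_n expr1n ler_pdivrMr ?exprn_gt0//.
  rewrite -ler_pdivrMl ?divr_gt0// mulr1.
  apply: (@le_trans _ _ n%:R); first by near: n; exact: nbhs_infty_ger.
  by rewrite -natrX ler_nat ltnW// ltnW// ltn_expl.
have [w wn] := prim_root_exists (natr_neq0 v_nat (ltn0Sn n)).
(* Summed over q omitted values, the terms at y contribute at least G q, those
   at each other point of the circle at least -3, and the mean value inequality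
   leaves at most G q / 2 in total. So G q > 6 n is already contradictory. *)
have [q qn] : exists q, 12 * n.+1%:R < G * q%:R.
  near \oo => q; exists q; rewrite -ltr_pdivrMl//.
  by near: q; exact: nbhs_infty_gtr.
have [s0 sE sq] := infinite_set_fset q Einf.
pose s : seq K := finmap.enum_fset s0.
have us : uniq s by apply: finmap.fset_uniq.
have Es a : a \in s -> E a by move=> sa; apply: sE.
have {}qn : 12 * n.+1%:R < G * (size s)%:R.
  by rewrite (lt_le_trans qn)// ler_pM2l// ler_nat.
have [del /andP[del0 del1] sep] := separated_seq s.
have zx j : v (x + u * w ^+ j - x) < r / 2.
  rewrite addrC addKr abvM abvX.
  by rewrite (abv_unity v _ (prim_expr_order wn))// expr1n mulr1.
have c0 : 0 < G / (4 * n.+1%:R) by rewrite divr_gt0// mulr_gt0.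
pose B k := - ln del / (d ^ k)%:R.
have B0 k : 0 <= B k by rewrite divr_ge0 ?(ltW (dk_gt0 k))// oppr_ge0 ln_le0.
near \oo => k.
have Bk : B k *+ size s <= 1.
  rewrite -mulr_natr mulrAC ler_pdivrMr//.
  by near: k; apply: degree_large.
have mean a : a \in s ->
    \sum_(0 <= j < n.+1) log_iter a k (x + u * w ^+ j) <= G / 2.
  move=> sa.
  have : log_iter a k x <= G / (4 * n.+1%:R).
    move: a sa; near: k; apply: near_in_seq => a sa.
    by apply: (@log_iter_bounded a x M) => // j; apply/omit_x/Es.
  move=> xG; apply: (@le_trans _ _ (log_iter a k x *+ n.+1 + t ^+ n.+1)).
    apply: (log_iter_mean r0) => //; last lra.
    by move=> z; apply/omit/Es.
  have : log_iter a k x *+ n.+1 <= G / 4.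
    rewrite -[leLHS]mulr_natr -ler_pdivlMr//; apply: le_trans xG _.
    by rewrite invfM mulrA.
  lra.
have Gy a : a \in s -> G <= log_iter a k y.
  by move: a; near: k; apply: near_in_seq => a sa; apply: HG.
(* The orbit point F k z is within del of at most one element of s, where the
   potential is still at least -2; the other terms are at least - B k, and
   their sum is at least -1. *)
have low j : (j < n.+1)%N ->
    - 3 <= \sum_(a <- s) log_iter a k (x + u * w ^+ j).
  move=> jn.
  have logz : forall a, a \in s -> - 2 <= log_iter a k (x + u * w ^+ j).
    have : j \in iota 0 n.+1 by rewrite mem_iota.
    move: j {jn}; near: k; apply: near_in_seq => j _.
    by apply: near_in_seq => a sa; apply: log_z; [exact: Es|exact: zx].
  have := @sum_ge_almost R K s (fun a => log_iter a k (x + u * w ^+ j)) 2 (B k).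
  set z := x + _ in logz *; move=> /(_ us _ (B0 k) logz) H.
  suff : - 2 - B k *+ size s <= \sum_(a <- s) log_iter a k z by lra.
  apply: H => // a b sa sb ab.
  have far c : del <= v (F k z - c) -> - B k <= log_iter c k z.
    move=> dc; rewrite /B mulNr opprK ler_pM2r ?invr_gt0//.
    by rewrite ler_ln ?posrE// (lt_le_trans del0).
  have := sep _ _ sa sb ab.
  have := abvB v (F k z - b) (F k z - a).
  have -> : F k z - b - (F k z - a) = a - b by ring.
  have [/far->//|da] := leP del (v (F k z - a)).
  move=> h1 h2; rewrite [X in _ || X]far ?orbT//; lra.
have : \sum_(0 <= j < n.+1) \sum_(a <- s) log_iter a k (x + u * w ^+ j)
   <= G / 2 * (size s)%:R.
  rewrite exchange_big/= mulr_natr -sum_const_seq big_seq [leRHS]big_seq.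
  exact: ler_sum.
rewrite big_nat_recl// expr0 mulr1.
have -> : x + u = y by rewrite /u addrC subrK.
have : G * (size s)%:R <= \sum_(a <- s) log_iter a k y.
  rewrite mulr_natr -sum_const_seq big_seq [leRHS]big_seq.
  exact: ler_sum.
have : - 3 * n%:R <=
    \sum_(0 <= j < n) \sum_(a <- s) log_iter a k (x + u * w ^+ j.+1).
  rewrite mulr_natr -[n in leLHS]subn0 -sumr_const_nat.
  by apply: ler_sum_nat => j jn; apply: low.
move: qn; rewrite -[n.+1%:R]natr1; have : 0 <= n%:R :> R by [].
move: (n%:R : R) ((size s)%:R : R) => N S; lra.
Unshelve. all: by end_near. Qed.

End LogIterate.

(** * The Archimedean case *)

Section ArchimedeanEquicontinuity.
Variables (R : realType) (K : closedFieldType) (v : absValue R K).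
Hypothesis v_nat : forall n : nat, v n%:R = n%:R.

Variable h : K -> R.
Hypothesis h_ge1 : forall z, 1 <= h z.
Hypothesis h_ge : forall z, v z <= h z.

Let h_gt0 z : 0 < h z.
Proof. exact: lt_le_trans (h_ge1 z). Qed.

Lemma chordal_le_abv a b : chordal v h (Some a) (Some b) <= v (a - b).
Proof.
rewrite /= ler_pdivrMr ?mulr_gt0// ler_peMr ?abv_ge0//.
by rewrite (le_trans (h_ge1 a))// ler_peMr// ltW.
Qed.

Lemma chordal_le_escape a b (L : R) : 0 < L -> L <= v a -> L <= v b ->
  chordal v h (Some a) (Some b) <= 2 / L.
Proof.
move=> L0 La Lb /=; rewrite ler_pdivrMr ?mulr_gt0//.
have ha := le_trans La (h_ge a); have hb := le_trans Lb (h_ge b).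
apply: le_trans (abvB _ _ _) _; apply: le_trans (lerD (h_ge a) (h_ge b)) _.
rewrite mulrAC ler_pdivlMr// mulrDl.
have := ler_wpM2l (ltW (h_gt0 a)) hb; have := ler_wpM2r (ltW (h_gt0 b)) ha.
lra.
Qed.

(** Case distinction on the orbit of x. If it reaches the escape radius, so do
    the orbits of all nearby points at the same time, after which all of them
    tend to infinity at a uniform rate. If not, the orbits of the points near x
    do not escape either, by [omitted_orbit_normal], and the iterates are
    uniformly bounded. *)
Lemma archimedean_equicontinuous (f : {poly K}) (U : set K) (alpha beta x : K)
    (eps : R) :
  (1 < (size f).-1)%N -> alpha != beta ->
  (forall y, U y -> exists2 r, 0 < r & forall z, v (z - y) < r -> U z) ->
  (forall z k, U z -> iter k (horner f) z != alpha) ->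
  (forall z k, U z -> iter k (horner f) z != beta) ->
  U x -> 0 < eps ->
  exists2 s, 0 < s & forall z, v (z - x) < s -> forall k,
    chordal v h (Some (iter k (horner f) z))
      (Some (iter k (horner f) x)) < eps.
Proof.
move=> d1 ab oU Ua Ub Ux eps0; set d := (size f).-1 in d1 *.
have [rho [rho_f rho_j]] := escape_radius v d1.
have iter_cont k e : 0 < e -> exists2 s, 0 < s & forall z, v (z - x) < s ->
    v (iter k (horner f) z - iter k (horner f) x) < e.
  move=> e0; have [s s0 H] := poly_abv_continuous v_nat (iter_poly f k) x e0.
  by exists s => // z /H; rewrite !horner_iter_poly.
have [[k0 xesc]|xbnd] := pselect (exists k, rho <= v (iter k (horner f) x)).
  pose k1 := k0.+1.
  have xk1 : rho < v (iter k1 (horner f) x) by rewrite iterS rho_f.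
  have [s1 s10 Hs1] : exists2 s, 0 < s & forall z, v (z - x) < s ->
      rho <= v (iter k1 (horner f) z).
    rewrite -subr_gt0 in xk1; have [s s0 H] := iter_cont k1 _ xk1.
    exists s => // z /H; rewrite abv_distC => zk.
    have := abv_leB v (iter k1 (horner f) x) (iter k1 (horner f) z); lra.
  have [J HJ] : exists J : nat, 2 < eps * J%:R.
    near \oo => J; exists J.
    by rewrite -ltr_pdivrMl//; near: J; exact: nbhs_infty_gtr.
  near (0 : R)^'+ => s.
  have s0 : 0 < s by near: s; exact: nbhs_right_gt.
  exists s => // z zx k; case: (ltnP k (J + k1)) => kJ; last first.
    rewrite -(subnK (leq_trans (leq_addl J k1) kJ)) !iterD.
    set j := (k - k1)%N; have Jj : (J <= j)%N.
      by rewrite leq_subRL ?(leq_trans (leq_addl J k1) kJ)// addnC.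
    have J0 : (0 : R) < J%:R by rewrite -(pmulr_rgt0 _ eps0); lra.
    have JL : J%:R <= 2 ^+ (d ^ j) :> R.
      rewrite -natrX ler_nat (leq_trans Jj)// ltnW//.
      by rewrite (ltn_trans (ltn_expl j d1))// ltn_expl.
    have L0 : (0 : R) < 2 ^+ (d ^ j) by rewrite exprn_gt0.
    apply: (@le_lt_trans _ _ (2 / 2 ^+ (d ^ j))).
      apply: chordal_le_escape => //; apply: rho_j; last exact: ltW.
      by apply: Hs1; rewrite (lt_le_trans zx)//; near: s; exact: nbhs_right_le.
    by rewrite ltr_pdivrMr// (lt_le_trans HJ)// ler_pM2l.
  apply: le_lt_trans (chordal_le_abv _ _) _.
  have : k \in iota 0 (J + k1) by rewrite mem_iota.
  move=> kI; move: k kI {kJ} z zx; near: s; apply: near_in_seq => k _.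
  have [s2 s20 H] := iter_cont k _ eps0.
  near=> s => z zx; apply: H; apply: lt_le_trans zx _.
  by near: s; exact: nbhs_right_le.
have xrho k : v (iter k (horner f) x) <= rho.
  by rewrite leNgt; apply/negP => xk; apply: xbnd; exists k; exact: ltW.
pose E := [set a | forall z k, U z -> iter k (horner f) z != a].
have Einf : infinite_set E.
  apply: (@backward_invariant_infinite K f E alpha beta) => //.
    by rewrite (natr_neq0 v_nat)// ltnW.
  move=> w Ew z k Uz; apply/eqP => zw.
  by have /eqP := Ew z k.+1 Uz; apply; rewrite iterS zw.
have [r r0 rU] := oU x Ux.
have [s s0 Hs] := omitted_orbit_normal v_nat d1 r0 Einf
  (fun a Ea k z zx => Ea z k (rU z zx)) xrho.
have bnd z k : v (z - x) < s -> v (iter k (horner f) z) <= rho.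
  move=> zx; rewrite leNgt; apply/negP => /ltW zk.
  by apply: (Hs z k zx) => j; rewrite iterD; apply: rho_j.
have [t t0 Ht] := bounded_equicontinuous v_nat rho s0 eps0.
exists t => // z zx k; apply: le_lt_trans (chordal_le_abv _ _) _.
have := Ht (iter_poly f k) x; rewrite -!horner_iter_poly; apply=> // w wx.
by rewrite horner_iter_poly; apply: bnd.
Unshelve. all: by end_near. Qed.

End ArchimedeanEquicontinuity.

Definition complex_absValue (R : realType) : absValue R (Rcomplex R) :=
  AbsValue (@absC_ge0 R) (@absC_eq0 R) (@absCM R) (@absCD R).

Lemma absC_nat (R : realType) n : absC (n%:R : Rcomplex R) = n%:R.
Proof.
have C1 : absC (1 : Rcomplex R) = 1 by exact: (abv1 (complex_absValue R)).
by rewrite /absC normrMn [X in X *+ _]C1.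
Qed.

Lemma cnorm1_ge1 (R : realType) (z : Rcomplex R) : 1 <= cnorm1 z.
Proof.
rewrite -(ler_pXn2r (n := 2))// ?nnegrE ?cnorm1_ge0//.
by rewrite sqr_cnorm1 expr1n lerDl sqr_ge0.
Qed.

(** * Both cases together *)

Theorem theorem2p3 (R : realType) :
  (forall (U : set (Rcomplex R)) (f : {poly Rcomplex R})
      (alpha beta : Rcomplex R),
    open U -> (2 <= (size f).-1)%N -> alpha <> beta ->
    orbit_set (horner f) U `&` [set alpha; beta] = set0 ->
    equicontinuous_on (polyP1 f : complexP1 R -> complexP1 R)
                      (Some @` U : set (complexP1 R)))
  /\
  (forall (K : closedFieldType) (v : nonArchAbs R K),
    complete_space (valued v) ->
    forall (U : set (valued v)) (f : {poly valued v}) (alpha beta : valued v),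
    open U -> (2 <= (size f).-1)%N ->
    orbit_set (horner f) U `&` [set alpha; beta] = set0 ->
    equicontinuous_on (polyP1 f : nonArchP1 v -> nonArchP1 v)
                      (Some @` U : set (nonArchP1 v))).
Proof.
split=> [U f alpha beta oU d1 /eqP ab UE|K v _ U f alpha beta oU d1 UE].
  apply: (@equicontinuous_chordal R (Rcomplex R) (complex_absValue R)
    (@cnorm1 R) f (complexP1 R) _ _ U id) => //.
  - exact: cnorm1_ge1.
  - exact: cnorm1D.
  - by move=> y [z Uz <-]; exists z.
  move=> x Ux eps eps0.
  apply: (@archimedean_equicontinuous R (Rcomplex R) (complex_absValue R)
    (@absC_nat R) (@cnorm1 R) (@cnorm1_ge1 R) (@norm_le_cnorm1 R)
    f U alpha beta) => //.
  - move=> y Uy; have [r r0 rU] := open_ball oU Uy.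
    by exists r => // z zy; apply: rU.
  - by move=> z k Uz; apply/eqP/(orbit_set_omits UE) => //; left.
  - by move=> z k Uz; apply/eqP/(orbit_set_omits UE) => //; right.
apply: (@equicontinuous_chordal R K (nonarch_absValue v)
  (@nanorm1 R K v) f (nonArchP1 v) _ _ U id) => //.
- by move=> z; rewrite le_max lexx.
- exact: nanorm1D.
- by move=> y [z Uz <-]; exists z.
move=> x Ux eps eps0; have [r r0 rU] := open_ball oU Ux.
apply: (@nonarch_equicontinuous R K v f x alpha r eps) => // z zx k.
apply/eqP/(orbit_set_omits UE); [by left|apply: rU].
by rewrite metric_sym.
Qed.
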